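(* Let $N$ be a developable regular ruled surface in $E^3$ with parametrization $\vec r(s,v)=\vec c(s)+v\vec q(s)$, $\|\vec q(s)\|=1$, where $\vec c$ is the striction curve (striction line) of $N$ and $s$ is the arc length parameter of $\vec c$, with Frenet frame $\{\vec q,\vec h,\vec a\}$ and non-zero invariants $k_1,k_2$. Then $N$ is a $q$-slant ruled surface if and only if the striction line $\vec c(s)$ is a general helix in $E^3$.
   Context: All maps are smooth and defined on an open interval $I\subset\mathbb R$; $E^3$ is Euclidean 3-space. $N$ is given by $\vec r(s,v)=\vec c(s)+v\vec q(s)$, where $\vec c$ is a unit speed curve and $\vec q$ is a unit vector field along $\vec c$ (the ruling). ''Regular'' refers to the base curve $\vec c$ being a regular curve (here unit speed); points where $\vec r$ fails to be an immersion are not excluded. That $\vec c$ is the striction curve means $\langle \vec c\,',\vec q\,'\rangle=0$. Frenet frame of $N$: $\vec a=\dfrac{\vec q\times\vec q\,'}{\|\vec q\,'\|}$ (central tangent), $\vec h=\vec a\times\vec q$ (central normal). The invariants $k_1,k_2$ are the functions in the Frenet formulae $$\vec q\,'=k_1\vec h,\qquad \vec h'=-k_1\vec q+k_2\vec a,\qquad \vec a'=-k_2\vec h,$$ with $'=d/ds$; both are assumed nowhere zero (so $k_1=\|\vec q\,'\|>0$). $N$ is developable if its distribution parameter $d=\det(\vec c\,',\vec q,\vec q\,')/\langle\vec q\,',\vec q\,'\rangle$ vanishes identically. $N$ is called $q$-slant if there is a fixed unit vector $\vec u$ and a constant angle $\theta\neq\pi/2$ with $\langle\vec q(s),\vec u\rangle=\cos\theta$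 for all $s$. A curve is a general helix if its unit tangent makes a constant angle with a fixed direction, i.e. there is a fixed unit vector $\vec u$ such that $\langle \vec c\,'(s),\vec u\rangle$ is constant. *)

(* Defs.v *)
From HB Require Import structures.
From mathcomp Require Import all_boot all_order all_algebra.
From mathcomp Require Import all_classical all_reals all_analysis.

Set Implicit Arguments.
Unset Strict Implicit.
Unset Printing Implicit Defensive.

Import Order.TTheory GRing.Theory Num.Theory numFieldNormedType.Exports.

Local Open Scope classical_set_scope.
Local Open Scope ring_scope.

Section EuclideanSpace.
Context {R : realType}.
Implicit Types u v w : 'rV[R]_3.

Definition dot u v : R := (u *m v^T) 0 0.

(* The library norm `|u| on row vectors is the sup norm, hence this one. *)
Definition enorm u : R := Num.sqrt (dot u u).

(* Indices are taken in 'I_3 = Z/3, so that i + 1 and i + 2 are cyclic. *)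
Definition cross u v : 'rV[R]_3 :=
  \row_i (u 0 (i + 1) * v 0 (i + 2%:R) - u 0 (i + 2%:R) * v 0 (i + 1)).

Definition det3 u v w : R := \det (col_mx u (col_mx v w)).

End EuclideanSpace.

(* In ring_scope, which the arguments of dot and cross open, this notation
   would otherwise be the derivative of polynomials. *)
Local Notation "f ^` ()" := (derive1 f) : ring_scope.

Section RuledSurfaces.
Context {R : realType}.
Implicit Types (I : set R) (c q : R -> 'rV[R]_3).

(* Curves are total functions whose values off I are irrelevant: since I is
   open, neither do they affect the iterated derivatives at points of I. *)
Definition smooth_on I c : Prop :=
  forall n s, I s -> derivable c^`(n)%classic s 1.

Record ruled_surface I (r : R -> R -> 'rV[R]_3) c q : Prop := RuledSurface {
  rs_open : open I;
  rs_interval : is_interval I;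
  rs_smooth_base : smooth_on I c;
  rs_smooth_ruling : smooth_on I q;
  rs_param : forall s v, I s -> r s v = c s + v *: q s;
  rs_unit_speed : forall s, I s -> enorm (c^`() s) = 1;
  rs_unit_ruling : forall s, I s -> enorm (q s) = 1
}.

Definition striction_curve I c q : Prop :=
  forall s, I s -> dot (c^`() s) (q^`() s) = 0.

Definition distribution_parameter c q (s : R) : R :=
  det3 (c^`() s) (q s) (q^`() s) / dot (q^`() s) (q^`() s).

Definition developable I c q : Prop :=
  forall s, I s -> distribution_parameter c q s = 0.

Definition central_tangent q (s : R) : 'rV[R]_3 :=
  (enorm (q^`() s))^-1 *: cross (q s) (q^`() s).

Definition central_normal q (s : R) : 'rV[R]_3 :=
  cross (central_tangent q s) (q s).

(* The central tangent, hence the frame, and the distribution parameter only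
   make sense where q' does not vanish (division by 0 yields 0 here). *)
Definition has_frenet_frame I q : Prop :=
  forall s, I s -> q^`() s != 0.

Definition frenet_formulae I q (k1 k2 : R -> R) : Prop :=
  forall s, I s ->
  [/\ q^`() s = k1 s *: central_normal q s,
      (central_normal q)^`() s
        = - k1 s *: q s + k2 s *: central_tangent q s
    & (central_tangent q)^`() s = - k2 s *: central_normal q s].

(* An angle between unit vectors ranges over [0, pi]. *)
Definition q_slant I q : Prop :=
  exists (u : 'rV[R]_3) (theta : R),
    [/\ enorm u = 1, 0 <= theta <= pi, theta != pi / 2
      & forall s, I s -> dot (q s) u = cos theta].

(* For unit speed curves, whose unit tangent is c'. *)
Definition general_helix I c : Prop :=
  exists (u : 'rV[R]_3) (k : R),
    enorm u = 1 /\ forall s, I s -> dot (c^`() s) u = k.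

End RuledSurfaces.

(* Main.v *)
(* Developability and the striction condition make c' orthogonal to q' and to
   q x q', so c' is a multiple of q; both being unit vectors, c' = e q with
   e = 1 or e = -1, and e is constant by continuity. Hence <q, u> is constant
   if and only if <c', u> is, and it remains to exclude the angle pi/2. If
   <q, u> vanishes identically then so does <q', u>, hence the central tangent
   is u up to a sign, constant by continuity; its derivative -k2 h then
   vanishes, which is impossible. *)
Require Import Defs.
From mathcomp Require Import all_boot all_order all_algebra.
From mathcomp Require Import all_classical all_reals all_analysis.
From mathcomp Require Import ring lra.
Import Order.TTheory GRing.Theory Num.Theory numFieldNormedType.Exports.
Local Open Scope classical_set_scope.
Local Open Scope ring_scope.

(** * Coordinate identities for scalar, vector and triple products *)

Section Vectors.
Context {R : realType}.
Implicit Types u v w x y : 'rV[R]_3.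

Lemma dotE u v : dot u v = u 0 0 * v 0 0 + u 0 1 * v 0 1 + u 0 2%:R * v 0 2%:R.
Proof.
rewrite /dot mxE !big_ord_recl big_ord0 addr0 addrA !mxE.
by congr (_ * _ + _ * _ + _ * _); congr (_ _ _); apply/val_inj.
Qed.

Lemma crossE u v :
  [/\ cross u v 0 0 = u 0 1 * v 0 2%:R - u 0 2%:R * v 0 1,
      cross u v 0 1 = u 0 2%:R * v 0 0 - u 0 0 * v 0 2%:R
    & cross u v 0 2%:R = u 0 0 * v 0 1 - u 0 1 * v 0 0].
Proof.
have e11 : 1 + 1 = 2%:R :> 'I_3 by apply/val_inj.
have e12 : 1 + 2%:R = 0 :> 'I_3 by apply/val_inj.
have e21 : 2%:R + 1 = 0 :> 'I_3 by apply/val_inj.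
have e22 : 2%:R + 2%:R = 1 :> 'I_3 by apply/val_inj.
by split; rewrite mxE ?add0r ?e11 ?e12 ?e21 ?e22.
Qed.

Lemma det_mx33 (M : 'M[R]_3) :
  \det M = M 0 0 * (M 1 1 * M 2%:R 2%:R - M 1 2%:R * M 2%:R 1)
          + M 0 1 * (M 1 2%:R * M 2%:R 0 - M 1 0 * M 2%:R 2%:R)
          + M 0 2%:R * (M 1 0 * M 2%:R 1 - M 1 1 * M 2%:R 0).
Proof.
(* Reading entries through natural numbers lets the lifted ordinals of the cofactors compute to
   literals. *)
have [m ME] : exists m : nat -> nat -> R, forall i j, M i j = m i j.
  by exists (fun k l => M (inord k) (inord l)) => i j; rewrite !inord_val.
rewrite (expand_det_row _ 0) !big_ord_recl big_ord0 /cofactor.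
rewrite !(expand_det_row _ 0) !big_ord_recl !big_ord0 /cofactor !det_mx11.
by rewrite !mxE !ME /= /bump /=; ring.
Qed.

Lemma det3E u v w : det3 u v w = dot u (cross v w).
Proof.
rewrite /det3 dotE; case: (crossE v w) => -> -> ->.
have E0 j : col_mx u (col_mx v w) 0 j = u 0 j.
  by rewrite -(col_mxEu u (col_mx v w)); congr (_ _ j); apply/val_inj.
have E1 j : col_mx u (col_mx v w) 1 j = v 0 j.
  rewrite -(col_mxEu v w) -(col_mxEd u (col_mx v w)).
  by congr (_ _ j); apply/val_inj.
have E2 j : col_mx u (col_mx v w) 2%:R j = w 0 j.
  rewrite -(col_mxEd v w) -(col_mxEd u (col_mx v w)).
  by congr (_ _ j); apply/val_inj.
by rewrite det_mx33 !E0 !E1 !E2.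
Qed.

Lemma dotC u v : dot u v = dot v u.
Proof. by rewrite !dotE; ring. Qed.

Lemma dotZl a u v : dot (a *: u) v = a * dot u v.
Proof. by rewrite !dotE !mxE; ring. Qed.

Lemma dotBl u v w : dot (u - v) w = dot u w - dot v w.
Proof. by rewrite !dotE !mxE; ring. Qed.

Lemma dot_eq0 u : dot u u = 0 -> u = 0.
Proof.
rewrite dotE => /eqP; rewrite !paddr_eq0 -?expr2 ?addr_ge0 ?sqr_ge0 //.
rewrite !sqrf_eq0 => /andP[/andP[/eqP u0 /eqP u1] /eqP u2].
apply/rowP; case=> [[|[|[|]]]] // i; rewrite mxE.
- by rewrite -[RHS]u0; congr (u _ _); apply/val_inj.
- by rewrite -[RHS]u1; congr (u _ _); apply/val_inj.
- by rewrite -[RHS]u2; congr (u _ _); apply/val_inj.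
Qed.

Lemma dot_ge0 u : 0 <= dot u u.
Proof. by rewrite dotE -!expr2 !addr_ge0 ?sqr_ge0. Qed.

Lemma enorm_eq1 u : enorm u = 1 -> dot u u = 1.
Proof. by move=> u1; rewrite -(sqr_sqrtr (dot_ge0 u)) -/(enorm u) u1 expr1n. Qed.

Lemma lagrange u v :
  dot u u * dot v v = dot u v ^+ 2 + dot (cross u v) (cross u v).
Proof.
by rewrite !dotE; case: (crossE u v) => -> -> ->; ring.
Qed.

Lemma dot_crossr u v : dot (cross u v) v = 0.
Proof. by rewrite dotE; case: (crossE u v) => -> -> ->; ring. Qed.

(** The squared norm of [<u,w> v - <u,v> w], which is the triple product. *)
Lemma lagrange_triple u v w :
  dot (cross u (cross v w)) (cross u (cross v w)) =
  dot u w ^+ 2 * dot v v - dot u w * dot u v * dot v w *+ 2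
   + dot u v ^+ 2 * dot w w.
Proof.
rewrite !dotE; case: (crossE u (cross v w)) => -> -> ->.
by case: (crossE v w) => -> -> ->; ring.
Qed.

(** Equality case of Cauchy-Schwarz: the residual [u - <u,v> v] has squared norm
    [<u,u> - <u,v>^2]. *)
Lemma dot_sqr_parallel u v :
  dot v v = 1 -> dot u v ^+ 2 = dot u u -> u = dot u v *: v.
Proof.
move=> v1 uv; apply/subr0_eq/dot_eq0.
rewrite dotBl dotZl 2!(dotC _ (u - _)) !dotBl !dotZl v1 (dotC v u) -uv.
by ring.
Qed.

(** Pythagoras for [u] in the orthogonal frame [v], [w], [v x w], multiplied by [<w,w>] so that
    [w = 0] is allowed. *)
Lemma dot_cross_sqr u v w : dot u u = 1 -> dot v v = 1 -> dot v w = 0 ->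
  dot (cross v w) u ^+ 2 = (1 - dot u v ^+ 2) * dot w w - dot u w ^+ 2.
Proof.
move=> u1 v1 vw; have := lagrange u (cross v w).
rewrite lagrange_triple (dotC u (cross v w)).
have := lagrange v w; rewrite u1 v1 vw => vwE; lra.
Qed.

End Vectors.

(** * Derivatives of products of curves, and constancy of sign *)

Section Analysis.
Context {R : realType}.
Implicit Types (f g : R -> 'rV[R]_3) (s : R).

Lemma is_derive_coord f s i :
  derivable f s 1 -> is_derive s 1 (fun t => f t 0 i) ((f^`() s)%classic 0 i).
Proof.
move=> df; rewrite derive1E derive_mx // mxE; apply/derivableP.
by move/derivable_mxP : df; exact.
Qed.

Lemma is_derive_dot f g s : derivable f s 1 -> derivable g s 1 ->
  is_derive s 1 (fun t => dot (f t) (g t))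
    (dot (f^`() s)%classic (g s) + dot (f s) (g^`() s)%classic).
Proof.
move=> df dg; pose p i : R -> R := (fun t => f t 0 i) * (fun t => g t 0 i).
have -> : (fun t => dot (f t) (g t)) = p 0 + p 1 + p 2%:R.
  by apply/funext => t; rewrite dotE.
have dp i := is_deriveM (is_derive_coord f s i df) (is_derive_coord g s i dg).
apply: (is_derive_eq (is_deriveD (is_deriveD (dp 0) (dp 1)) (dp 2%:R))).
by rewrite !dotE /GRing.scale /=; ring.
Qed.

Lemma derivable_cross f g s : derivable f s 1 -> derivable g s 1 ->
  derivable (fun t => cross (f t) (g t)) s 1.
Proof.
move=> /derivable_mxP df /derivable_mxP dg; apply/derivable_mxP => i j.
under eq_fun do rewrite mxE.
by apply: derivableB; apply: derivableM.
Qed.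

Lemma derivable_dot_continuous f g s : derivable f s 1 -> derivable g s 1 ->
  {for s, continuous (fun t => dot (f t) (g t))}.
Proof.
move=> df dg; apply/differentiable_continuous/derivable1_diffP.
by have [] := is_derive_dot f g s df dg.
Qed.

End Analysis.

(** By the intermediate value theorem, two different signs would force a zero in between. *)
Lemma sgr_const (R : realType) (I : set R) (f : R -> R) :
    is_interval I -> (forall s, I s -> {for s, continuous f}) ->
    (forall s, I s -> f s != 0) ->
  forall s t, I s -> I t -> Num.sg (f s) = Num.sg (f t).
Proof.
move=> itvI cf f0.
suff H s t : I s -> I t -> s <= t -> Num.sg (f s) = Num.sg (f t).
  by move=> s t Is It; have [/H|/ltW/H] := leP s t => ->.
move=> Is It st; apply/eqP/negPn/negP => fst.
have sub x : x \in `[s, t] -> I x.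
  by rewrite in_itv /= => /(itvI s t Is It).
have cst : {within `[s, t], continuous f}.
  by apply: continuous_in_subspaceT => x; rewrite inE /= => /sub; exact: cf.
have : Num.min (f s) (f t) <= 0 <= Num.max (f s) (f t).
  rewrite ge_min le_max.
  have /lt_total/orP[fs|fs] := f0 _ Is; have /lt_total/orP[ft|ft] := f0 _ It.
  - by rewrite (ltr0_sg fs) (ltr0_sg ft) eqxx in fst.
  - by rewrite (ltW fs) (ltW ft) !orbT.
  - by rewrite (ltW fs) (ltW ft) !orbT.
  - by rewrite (gtr0_sg fs) (gtr0_sg ft) eqxx in fst.
by move=> /(IVT st cst)[x /sub/f0/eqP].
Qed.

(** * Tangent of the striction line and directions orthogonal to the ruling *)

Section Surface.
Context {R : realType} (I : set R) (r : R -> R -> 'rV[R]_3).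
Context (c q : R -> 'rV[R]_3) (k1 k2 : R -> R).
Context (hN : ruled_surface I r c q) (hframe : has_frenet_frame I q).
Context (hfrenet : frenet_formulae I q k1 k2).

Let derivable_q s : I s -> derivable q s 1.
Proof. by have /(_ 0%N s) := rs_smooth_ruling hN. Qed.

Let derivable_dq s : I s -> derivable (q^`())%classic s 1.
Proof. by have /(_ 1%N s) := rs_smooth_ruling hN. Qed.

Let derivable_dc s : I s -> derivable (c^`())%classic s 1.
Proof. by have /(_ 1%N s) := rs_smooth_base hN. Qed.

Let dot_qq s : I s -> dot (q s) (q s) = 1.
Proof. by move=> Is; apply/enorm_eq1/(rs_unit_ruling hN). Qed.

(** The first Frenet formula makes [q'] a multiple of [h = a x q], which is orthogonal to [q]. *)
Let dot_qdq s : I s -> dot (q s) ((q^`())%classic s) = 0.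
Proof.
by case/hfrenet => -> _ _; rewrite dotC dotZl [X in _ * X]dot_crossr mulr0.
Qed.

Let dot_dqdq s : I s -> dot ((q^`())%classic s) ((q^`())%classic s) != 0.
Proof. by move=> Is; apply: contra (hframe s Is) => /eqP/dot_eq0 ->. Qed.

Lemma developable_tangent : striction_curve I c q -> developable I c q ->
  exists2 e : R, e != 0 & forall s, I s -> (c^`())%classic s = e *: q s.
Proof.
move=> hs hd; pose x s := dot ((c^`())%classic s) (q s).
have dcdc s : I s -> dot ((c^`())%classic s) ((c^`())%classic s) = 1.
  by move=> Is; apply/enorm_eq1/(rs_unit_speed hN).
have x1 s : I s -> x s ^+ 2 = 1.
  move=> Is.
  (* Here [<q x q', c'>^2 = (1 - x^2) |q'|^2 - <c', q'>^2], where developability kills the left side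
     and striction the last term. *)
  have := dot_cross_sqr _ _ _ (dcdc s Is) (dot_qq s Is) (dot_qdq s Is).
  have /eqP := hd s Is; rewrite mulf_eq0 invr_eq0 (negPf (dot_dqdq s Is)) orbF.
  rewrite det3E dotC => /eqP ->; rewrite hs // expr0n subr0 => /esym/eqP.
  by rewrite mulf_eq0 (negPf (dot_dqdq s Is)) orbF subr_eq0 => /eqP.
have cE s : I s -> (c^`())%classic s = x s *: q s.
  by move=> Is; apply: dot_sqr_parallel; rewrite ?dot_qq // dcdc // x1.
have x0 s : I s -> x s != 0 by move=> Is; rewrite -sqrf_eq0 x1 ?oner_eq0.
(* Being 1 or -1, [x] equals its own sign, so constancy of sign is constancy of [x]. *)
have xsg s : I s -> x s = Num.sg (x s).
  move=> Is; have /eqP := x1 s Is; rewrite sqrf_eq1 => /orP[]/eqP ->.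
    by rewrite sgr1.
  by rewrite sgrN1.
have [[s0 Is0]|I0] := pselect (exists s, I s); last first.
  by exists 1; rewrite ?oner_eq0// => s Is; case: I0; exists s.
exists (x s0); first exact: x0.
move=> s Is; rewrite cE // xsg // [in RHS]xsg //; congr (_ *: _).
apply: (sgr_const _ I) => //; first exact: (rs_interval hN).
move=> t It; apply: derivable_dot_continuous; first exact: derivable_dc.
exact: derivable_q.
Qed.

(** The point [s0] rules out an empty [I], on which the orthogonality would hold vacuously. *)
Lemma ruling_not_orthogonal u s0 : (forall s, I s -> k2 s != 0) -> I s0 ->
  enorm u = 1 -> ~ (forall s, I s -> dot (q s) u = 0).
Proof.
move=> hk2 Is0 /enorm_eq1 u1 qu.
have nearI s : I s -> \forall t \near s, I t.
  by move=> Is; apply: open_nbhs_nbhs; split => //; exact: (rs_open hN).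
have dqu s : I s -> dot ((q^`())%classic s) u = 0.
  (* The function vanishes only on [I]; openness makes it zero near [s], which determines the
     derivative. *)
  move=> Is; have D0 : 'D_1 (fun t => dot (q t) u) s = 0.
    rewrite -[RHS](derive_cst (0 : R) s (1 : R)); apply: near_eq_derive.
    by apply: filterS (nearI s Is) => t It; exact: qu.
  have [_] :=
    is_derive_dot q (cst u) s (derivable_q s Is) (derivable_cst _ _ _).
  by rewrite D0 derive1_cst [X in _ + X]dotE !mxE !mulr0 !addr0.
pose n s := cross (q s) ((q^`())%classic s); pose g s := dot (n s) u.
(* As [u] is orthogonal to [q] and [q'], all of it lies along [n = q x q']; hence
   [g^2 = |q'|^2 = |n|^2] and [n = g u]. *)
have g2 s : I s -> g s ^+ 2 = dot ((q^`())%classic s) ((q^`())%classic s).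
  move=> Is; rewrite (dot_cross_sqr _ _ _ u1 (dot_qq s Is) (dot_qdq s Is)).
  by rewrite !(dotC u) dqu // qu // expr0n /= !subr0 mul1r.
have nn s : I s -> g s ^+ 2 = dot (n s) (n s).
  move=> Is; rewrite g2 //; have := lagrange (q s) ((q^`())%classic s).
  by rewrite dot_qq // dot_qdq // expr0n add0r mul1r.
have g0 s : I s -> g s != 0 by move=> Is; rewrite -sqrf_eq0 g2 ?dot_dqdq.
have sgE s : I s -> Num.sg (g s) = Num.sg (g s0).
  move=> Is; apply: (sgr_const _ I _ (rs_interval hN) _ g0 _ _ Is Is0) => t It.
  apply: derivable_dot_continuous; last exact: derivable_cst.
  by apply: derivable_cross; [exact: derivable_q|exact: derivable_dq].
(* Dividing [n = g u] by [|q'| = |g|] leaves the sign of [g]. *)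
have aE s : I s -> central_tangent q s = Num.sg (g s0) *: u.
  move=> Is; rewrite /central_tangent -/(n s) /enorm -g2 // sqrtr_sqr.
  rewrite (dot_sqr_parallel _ _ u1 (nn s Is)) scalerA -/(g s) -(sgE s) //.
  by rewrite {2}[g s]numEsg mulrCA mulVf ?normr_eq0 ?g0 // mulr1.
have [qh _] := hfrenet s0 Is0.
have -> : (central_tangent q)^`()%classic s0 = 0.
  rewrite derive1E -[RHS](derive_cst (Num.sg (g s0) *: u) s0 (1 : R)).
  by apply: near_eq_derive; apply: filterS (nearI s0 Is0) => t; exact: aE.
(* From [-k2 h = 0] follows [h = 0], so [q' = k1 h = 0], against the existence of the frame. *)
move=> /esym/eqP; rewrite scaler_eq0 oppr_eq0 (negPf (hk2 s0 Is0)) /= => /eqP h0.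
by have := hframe s0 Is0; rewrite qh h0 scaler0 eqxx.
Qed.

End Surface.

Theorem theorem3p5 (R : realType) (I : set R)
    (r : R -> R -> 'rV[R]_3) (c q : R -> 'rV[R]_3) (k1 k2 : R -> R)
    (hN : ruled_surface I r c q)
    (hstriction : striction_curve I c q)
    (hdevelopable : developable I c q)
    (hframe : has_frenet_frame I q)
    (hfrenet : frenet_formulae I q k1 k2)
    (hk1 : forall s, I s -> k1 s != 0)
    (hk2 : forall s, I s -> k2 s != 0) :
  q_slant I q <-> general_helix I c.
Proof.
have [e e0 cE] := developable_tangent I r c q k1 k2 hN hframe hfrenet
  hstriction hdevelopable.
split=> [[u [theta [u1 _ _ qu]]]|[u [k [u1 cu]]]].
  by exists u, (e * cos theta); split=> // s Is; rewrite cE // dotZl qu.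
(* Over an empty [I] any angle other than [pi / 2] serves; 0 is taken. *)
have [[s0 Is0]|I0] := pselect (exists s, I s); last first.
  exists u, 0; split=> // [||s Is]; last by case: I0; exists s.
    by rewrite lexx pi_ge0.
  by rewrite eq_sym gt_eqF // divr_gt0 ?pi_gt0.
have qu s : I s -> dot (q s) u = k / e.
  by move=> Is; rewrite -(cu s Is) cE // dotZl mulrAC mulfV // mul1r.
(* Cauchy-Schwarz for the unit vectors [q s0] and [u], read off Lagrange's identity, so that [acos]
   inverts [cos] at [k / e]. *)
have m1 : -1 <= k / e <= 1.
  rewrite -ler_norml -(@expr_le1 _ 2) // real_normK ?num_real // -(qu s0 Is0).
  rewrite -[leRHS]mulr1 -{1}(enorm_eq1 _ (rs_unit_ruling hN Is0)).
  by rewrite -(enorm_eq1 _ u1) lagrange lerDl dot_ge0.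
have mE : cos (acos (k / e)) = k / e by apply: acosK; rewrite in_itv.
exists u, (acos (k / e)); split=> //.
- by rewrite acos_ge0 ?acos_lepi.
(* The angle [pi / 2] would make [u] orthogonal to every ruling. *)
- apply/eqP => acosE.
  apply: (ruling_not_orthogonal I r c q k1 k2 hN hframe hfrenet u s0 hk2 Is0 u1).
  by move=> s Is; rewrite qu // -mE acosE cos_pihalf.
- by move=> s Is; rewrite mE qu.
Qed.
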